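(* Let $P\geq 2$ be an even integer and let $G$ be a finite connected trivalent graph of genus $g\geq 2$. Then $$|\operatorname{Ed}_{P,1,G}|=\left(\frac P2\right)^{g-1}+\left(\frac P4\right)^{g-1}\sum_{\theta=1}^{P/2-1}\csc^{2g-2}\!\left(\frac{\pi\theta}{P}\right).$$
   Context: Finite graphs: a finite graph $G$ consists of finite sets $V(G)$, $E(G)$, $H(G)$ of vertices, edges and half-edges, with maps $\nu:H(G)\to V(G)$ and $\epsilon:H(G)\to E(G)$ such that every fiber of $\epsilon$ has cardinality $2$. Multiple edges and loops are allowed. For a vertex $v$, $H_v=\nu^{-1}(v)$ is the set of branches incident to $v$. $G$ is trivalent if $|H_v|=3$ for every vertex $v$ (a loop at $v$ contributes two of the three branches). The genus of a connected graph is its first Betti number $|E(G)|-|V(G)|+1$. The set $\operatorname{Ed}_{P,1,G}$: let ${}^\dagger C_1(P)$ be the set of triples $(a_1,a_2,a_3)\in\mathbb{Z}_{\geq 0}^3$ such that $$a_1+a_2+a_3\leq P-2,\qquad |a_2-a_3|\leq a_1\leq a_2+a_3.$$ This set is invariant under permutations of the coordinates. $\operatorname{Ed}_{P,1,G}$ is the set of functions $\ell:E(G)\to\mathbb{Z}_{\geq 0}$ such that at every vertex $v$ the labels $\ell(\epsilon(h))$ of the three incident branches $h\in H_v$ form a triple in ${}^\dagger C_1(P)$. *)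

(* Defs.v *)
From mathcomp Require Import all_boot all_order all_algebra finmap.
From mathcomp Require Import boolp classical_sets functions cardinality reals.
From mathcomp Require Import trigo zify.

Set Implicit Arguments.
Unset Strict Implicit.
Unset Printing Implicit Defensive.

Import Order.TTheory GRing.Theory Num.Theory.

(* Half-edge graphs: loops and multiple edges are allowed. *)
Record graph := Graph {
  vertex : finType;
  edge : finType;
  half_edge : finType;
  nu : half_edge -> vertex;
  eps : half_edge -> edge;
  card_eps_fiber : forall e : edge, #|[set h | eps h == e]%SET| = 2 }.

Definition branches (G : graph) (v : vertex G) : {set half_edge G} :=
  [set h | nu h == v]%SET.

Definition adjacent (G : graph) : rel (vertex G) := fun v w =>
  [exists h, exists h', [&& eps h == eps h' :> edge G, nu h == v & nu h' == w]].

(* The empty graph does not count as connected. *)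
Definition connected_graph (G : graph) : Prop :=
  0 < #|vertex G| /\ forall v w : vertex G, connect (@adjacent G) v w.

Definition trivalent (G : graph) : Prop :=
  forall v : vertex G, #|branches v| = 3.

(* Computed in int, so that the subtraction is not truncated. *)
Definition genus (G : graph) : int :=
  (#|edge G|%:Z - #|vertex G|%:Z + 1)%R.

(* There is no parity condition on a1 + a2 + a3. The distance `|a2 - a3| is
   the one of ssrint, but P - 2 is truncated: only 2 <= P is meaningful. *)
Definition dagC1 (P : nat) : set (nat * nat * nat) :=
  [set a | let: (a1, a2, a3) := a in
     a1 + a2 + a3 <= P - 2 /\ `|a2 - a3| <= a1 <= a2 + a3]%classic.

Lemma dagC1_swap12 P a1 a2 a3 : dagC1 P (a1, a2, a3) -> dagC1 P (a2, a1, a3).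
Proof. by rewrite /dagC1/=; lia. Qed.

Lemma dagC1_swap23 P a1 a2 a3 : dagC1 P (a1, a2, a3) -> dagC1 P (a1, a3, a2).
Proof. by rewrite /dagC1/=; lia. Qed.

(* The branches at v are taken in every order, which is harmless since dagC1 P
   is invariant under permutations (dagC1_swap12, dagC1_swap23). When G is
   trivalent, h1, h2, h3 are necessarily distinct; a loop at v contributes its
   label twice. *)
Definition Ed (P : nat) (G : graph) : set {ffun edge G -> nat} :=
  [set l : {ffun edge G -> nat} |
    forall (v : vertex G) (h1 h2 h3 : half_edge G),
     branches v = [set h1; h2; h3]%SET ->
     dagC1 P (l (eps h1), l (eps h2), l (eps h3))]%classic.
Arguments Ed P G : clear implicits.

Definition csc (R : realType) (x : R) : R := ((sin x)^-1)%R.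

(* Main.v *)
Require Import Defs.
From mathcomp Require Import all_boot all_order all_algebra finmap.
From mathcomp Require Import boolp classical_sets functions cardinality reals.
From mathcomp Require Import trigo zify ring.

Local Open Scope ring_scope.

Set Implicit Arguments.
Unset Strict Implicit.
Unset Printing Implicit Defensive.

Import Order.TTheory GRing.Theory Num.Theory.

(** Put n = P / 2. Labels allowed at a vertex are smaller than n, and the
admissibility condition is the even part of the SU(2) fusion rules at level
P - 2: with s_i(a) = sin ((2a+1) pi (i+1) / P) for i, a < n, it has a Verlinde
formula
  [(c, a, b) admissible] = sum_i s_i(a) s_i(b) s_i(c) / (d_i s_i(0)),
where d_i is the squared norm of the row s_i ([fusion_rule]). This follows
from two facts: the rows s_i are orthogonal ([smx_row_orthogonal]), hence so
are the columns after weighting by 1 / d_i ([smx_col_orthogonal]); and the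
product s_i(a) s_i(b) expands over the admissible c with coefficient s_i(0)
([smx_clebsch_gordan], a telescoping sum).

The number of admissible labellings of G is then a state sum. Expanding the
product over the vertices gives a sum over colourings of the vertices by rows
i. For a fixed colouring, the sum over the labels factors over the edges, and
the factor of an edge is the inner product of the rows at its two ends. By
orthogonality only the locally constant colourings survive, and G is connected,
so what is left is a sum over one row i ([state_sum]):
  sum_i (d_i s_i(0))^(-|V|) d_i^|E|.
Trivalence gives |V| = 2(g-1) and |E| = 3(g-1) ([trivalent_genus]), so the
summand is d_i^(g-1) s_i(0)^(-2(g-1)). Here d_i = P / 4, except for the last
row i = n - 1, where d_i = P / 2 and s_i(0) = sin (pi / 2) = 1: this row is the
isolated term of the formula. *)

(** * State sums on half-edge graphs *)

Lemma prod_vertex_branches (F : comPzRingType) (G : graph)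
    (f : vertex G -> half_edge G -> F) :
  \prod_v \prod_(h in branches v) f v h = \prod_h f (nu h) h.
Proof.
rewrite [RHS](partition_big (@nu G) xpredT) //=; apply: eq_bigr => v _.
rewrite (eq_bigl (fun h => nu h == v)) => [|h]; last by rewrite inE.
by apply: eq_bigr => h /eqP ->.
Qed.

Lemma edge_halves (G : graph) (e : edge G) : exists h h' : half_edge G,
  [/\ h != h', eps h = e & eps h' = e].
Proof.
have /eqP/cards2P[h [h' [hh' /setP eE]]] := card_eps_fiber e.
exists h, h'; split=> //; apply/eqP.
  by have := eE h; rewrite !inE eqxx.
by have := eE h'; rewrite !inE eqxx orbT.
Qed.

Lemma prod_edge_halves (F : comPzRingType) (G : graph) (h h' : half_edge G)
    (f : half_edge G -> F) : h != h' -> eps h = eps h' ->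
  \prod_(k | eps k == eps h) f k = f h * f h'.
Proof.
move=> hh' eq_eps; have fiberE : [set k | eps k == eps h]%SET = [set h; h']%SET.
  apply/esym/eqP; rewrite eqEcard card_eps_fiber cards2 hh' andbT.
  by apply/fintype.subsetP => k; rewrite !inE => /orP[]/eqP->; rewrite ?eq_eps.
rewrite (eq_bigl (mem [set h; h']%SET)) => [|k]; last by rewrite -fiberE !inE.
by rewrite big_setU1 ?inE //= big_set1.
Qed.

Lemma connected_constant (T : eqType) (G : graph) (c : vertex G -> T) :
  connected_graph G ->
  (forall h h' : half_edge G, eps h = eps h' -> c (nu h) = c (nu h')) ->
  forall v w, c v = c w.
Proof.
move=> [_ conn] cE v w; have /connectP[p] := conn v w.
elim: p v => [|u p IHp] v /= => [_ -> //|/andP[vu pp] wE].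
rewrite -(IHp u) //; case/existsP: vu => h /existsP[h'].
by case/and3P=> /eqP/cE + /eqP <- /eqP <-.
Qed.

Lemma handshake (G : graph) :
  trivalent G -> (3 * #|vertex G| = 2 * #|edge G|)%N.
Proof.
move=> tri; transitivity #|half_edge G|.
  rewrite -[RHS]sum1_card (partition_big (@nu G) xpredT) //= mulnC -sum_nat_const.
  apply: eq_bigr => v _; rewrite -(tri v) -sum1_card.
  by apply: eq_bigl => h; rewrite inE.
rewrite -[LHS]sum1_card (partition_big (@eps G) xpredT) //= mulnC -sum_nat_const.
apply: eq_bigr => e _; rewrite -(card_eps_fiber e) -sum1_card.
by apply: eq_bigl => h; rewrite inE.
Qed.

(** Distributing the product over the vertices turns the left-hand side into a
sum over colourings of the vertices by T. The half-edges are then regrouped by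
edge, where the orthogonality of s kills every colouring that differs at the
two ends of some edge. *)
Lemma state_sum (F : comPzRingType) (T L : finType) (s : T -> L -> F)
    (d u : T -> F) (G : graph) :
    connected_graph G ->
    (forall t t', \sum_a s t a * s t' a = (t == t')%:R * d t) ->
  \sum_(l : {ffun edge G -> L})
     \prod_v \sum_t u t * \prod_(h in branches v) s t (l (eps h)) =
  \sum_t u t ^+ #|vertex G| * d t ^+ #|edge G|.
Proof.
move=> conn orth.
under eq_bigr => l _ do rewrite bigA_distr_bigA /=.
rewrite exchange_big /=.
transitivity (\sum_(c : {ffun vertex G -> T}) (\prod_v u (c v)) *
   \prod_e \sum_a \prod_(h | eps h == e) s (c (nu h)) a).
  apply: eq_bigr => c _; rewrite bigA_distr_bigA big_distrr /=.
  apply: eq_bigr => l _; rewrite big_split /=; congr (_ * _).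
  rewrite (prod_vertex_branches (fun v h => s (c v) (l (eps h)))).
  rewrite (partition_big (@eps G) xpredT) //=; apply: eq_bigr => e _.
  by apply: eq_bigr => h /eqP ->.
(* Colourings are sorted by their value at v0; only the constant one counts. *)
have [v0 _] : exists v0 : vertex G, true.
  by case: conn => /card_gt0P[v0 _] _; exists v0.
rewrite (partition_big (fun c : {ffun vertex G -> T} => c v0) xpredT) //=.
apply: eq_bigr => t _.
rewrite (bigD1 [ffun=> t]) /=; last by rewrite ffunE.
rewrite [X in _ + X]big1 ?addr0 => [|c /andP[/eqP ct cNt]].
  congr (_ * _).
    by under eq_bigr => v _ do rewrite ffunE; rewrite prodr_const.
  rewrite -prodr_const; apply: eq_bigr => e _.
  have [h [h' [hh' <- eh']]] := edge_halves e.
  under eq_bigr => a _ do rewrite (prod_edge_halves _ hh') // !ffunE.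
  by rewrite orth eqxx mul1r.
(* A non-constant colouring takes different values at the ends of some edge,
   and the factor of that edge is zero. *)
have [[h h'] /= /andP[/eqP hh' cNh]|cE] :=
    pickP [pred p : half_edge G * half_edge G |
      (eps p.1 == eps p.2) && (c (nu p.1) != c (nu p.2))].
  rewrite (bigD1 (eps h)) //= [X in _ * (X * _)](_ : _ = 0) ?mul0r ?mulr0 //.
  have hNh' : h != h' by apply: contraNneq cNh => ->.
  under eq_bigr => a _ do rewrite (prod_edge_halves _ hNh') //.
  by rewrite orth (negPf cNh) mul0r.
case/eqP: cNt; apply/ffunP => v; rewrite ffunE -ct.
apply: (connected_constant (c := c)) => // h h' hh'.
by have /negbT := cE (h, h'); rewrite /= hh' eqxx negbK => /eqP.
Qed.

(** * Trigonometric sums *)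

Section Trigonometry.
Variable R : realType.
Implicit Types (x y z : R) (n k : nat).

Lemma sin_pi_mulrn k : sin (pi *+ k) = 0 :> R.
Proof.
by elim: k => [|k IHk]; rewrite ?mulr0n ?sin0 // mulrSr sinDpi IHk oppr0.
Qed.

Lemma mul_sin_sin x y : 2 * (sin x * sin y) = cos (x - y) - cos (x + y).
Proof. by rewrite cosB cosD; ring. Qed.

Lemma sum_cos_odd n z :
  2 * sin z * \sum_(a < n) cos (a.*2.+1%:R * z) = sin (n.*2%:R * z).
Proof.
elim: n => [|n IHn]; first by rewrite big_ord0 mulr0 double0 mul0r sin0.
rewrite big_ord_recr /= mulrDr IHn.
have -> : n.+1.*2%:R * z = n.*2.+1%:R * z + z by rewrite doubleS -natr1; ring.
have -> : n.*2%:R * z = n.*2.+1%:R * z - z by rewrite -natr1; ring.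
by rewrite sinB sinD; ring.
Qed.

Lemma sum_sin_odd m n z : (m <= n)%N ->
  2 * sin z * \sum_(m <= a < n) sin (a.*2.+1%:R * z) =
  cos (m.*2%:R * z) - cos (n.*2%:R * z).
Proof.
move=> /subnKC <-; elim: (n - m)%N => [|k IHk].
  by rewrite addn0 big_geq // mulr0 subrr.
rewrite addnS big_nat_recr ?leq_addr //= mulrDr IHk; move: (m + k)%N => {IHk}k.
have -> : k.+1.*2%:R * z = k.*2.+1%:R * z + z by rewrite doubleS -natr1; ring.
have -> : k.*2%:R * z = k.*2.+1%:R * z - z by rewrite -natr1; ring.
by rewrite cosB cosD; ring.
Qed.

Definition angle n k : R := pi *+ k / n.*2%:R.

Lemma angle_mul n k : (0 < n)%N -> n.*2%:R * angle n k = pi *+ k.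
Proof. by move=> n_gt0; rewrite mulrC divfK // pnatr_eq0 double_eq0 -lt0n. Qed.

Lemma angleD n j k : angle n (j + k) = angle n j + angle n k.
Proof. by rewrite /angle mulrnDr mulrDl. Qed.

Lemma sin_angle_gt0 n k : (0 < k < n.*2)%N -> 0 < sin (angle n k).
Proof.
case/andP=> k_gt0 kn; have n_gt0 : 0 < n.*2%:R :> R by rewrite ltr0n; lia.
apply: sin_gt0_pi; apply/andP; split.
  by rewrite divr_gt0 // pmulrn_lgt0 // pi_gt0.
by rewrite ltr_pdivrMr // -[pi *+ k]mulr_natr ltr_pM2l ?pi_gt0 // ltr_nat.
Qed.

Lemma sum_cos_angle n k : (0 < k < n.*2)%N ->
  \sum_(a < n) cos (a.*2.+1%:R * angle n k) = 0.
Proof.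
move=> kn; have := sum_cos_odd n (angle n k).
rewrite angle_mul ?sin_pi_mulrn; last by lia.
have sn0 : 2 * sin (angle n k) != 0.
  by rewrite mulf_neq0 ?pnatr_eq0 // gt_eqF ?sin_angle_gt0.
by move/eqP; rewrite mulf_eq0 (negPf sn0) => /eqP.
Qed.

(** * The fusion rule *)

(** Up to normalization, the S-matrix of the fusion ring spanned by the even
weights at level P - 2, where P = 2n. The weight is 2a and the character is
i + 1. *)
Definition smx n (i a : 'I_n) : R := sin (a.*2.+1%:R * angle n i.+1).

(** The squared norm of the row i of smx. The last row is alternating in sign
with entries of absolute value 1, hence the exception. *)
Definition snorm n (i : 'I_n) : R := if i.+1 == n then n%:R else n%:R / 2.

Lemma snorm_neq0 n (i : 'I_n) : snorm i != 0.
Proof.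
have n_neq0 : n%:R != 0 :> R by rewrite pnatr_eq0 -lt0n (leq_trans _ (ltn_ord i)).
by rewrite /snorm; case: ifP => // _; rewrite mulf_neq0 // invr_eq0 pnatr_eq0.
Qed.

Lemma sum_cos_angle_diff n (i j : 'I_n) :
  \sum_(a < n) cos (a.*2.+1%:R * (angle n i.+1 - angle n j.+1)) =
  (i == j)%:R * n%:R.
Proof.
have lt0 (k l : 'I_n) : (k < l)%N ->
    \sum_(a < n) cos (a.*2.+1%:R * (angle n l.+1 - angle n k.+1)) = 0.
  move=> kl; have -> : l.+1 = ((l - k) + k.+1)%N by lia.
  rewrite angleD addrK sum_cos_angle //; have := ltn_ord l; lia.
have [ij|ji|/val_inj ->] := ltngtP i j.
- rewrite -val_eqE ltn_eqF // mul0r -[RHS](lt0 _ _ ij); apply: eq_bigr => a _.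
  by rewrite -cosN -mulrN opprB.
- by rewrite -val_eqE gtn_eqF // mul0r lt0.
rewrite eqxx mul1r -[n%:R in RHS]mulr1 mulr_natl -[in RHS](card_ord n) -sumr_const.
by apply: eq_bigr => a _; rewrite subrr mulr0 cos0.
Qed.

Lemma cos_odd_pi a : cos (a.*2.+1%:R * pi) = - 1 :> R.
Proof.
elim: a => [|a IHa]; first by rewrite mul1r cospi.
have -> : a.+1.*2.+1%:R * pi = a.*2.+1%:R * pi + pi *+ 2 :> R.
  by rewrite doubleS -natr1 -[in LHS]natr1 -[in RHS]natr1; ring.
by rewrite cosD2pi.
Qed.

Lemma sum_cos_angle_sum n (i j : 'I_n) :
  \sum_(a < n) cos (a.*2.+1%:R * (angle n i.+1 + angle n j.+1)) =
  - ((i == j) && (i.+1 == n))%:R * n%:R.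
Proof.
have ltin := ltn_ord i; have ltjn := ltn_ord j.
rewrite -angleD -val_eqE; have [|ijn] := boolP (_ && _).
  case/andP=> /eqP/= <- /eqP inE; rewrite mulN1r.
  have -> : (i.+1 + i.+1 = n.*2)%N by lia.
  have -> : angle n n.*2 = pi.
    by rewrite /angle -[pi *+ _]mulr_natr mulfK // pnatr_eq0; lia.
  under eq_bigr => a _ do rewrite cos_odd_pi.
  by rewrite sumr_const card_ord mulNrn.
by rewrite sum_cos_angle ?oppr0 ?mul0r //; move: ijn => /=; lia.
Qed.

(** By the product formula, this is a difference of two sums of cosines of odd
multiples of pi (i - j) / P and pi (i + j + 2) / P. Each of them vanishes unless
its angle is 0 or pi; the angle pi occurs only for i = j = n - 1. *)
Lemma smx_row_orthogonal n (i j : 'I_n) :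
  \sum_a smx i a * smx j a = (i == j)%:R * snorm i.
Proof.
have two_neq0 : 2 != 0 :> R by rewrite pnatr_eq0.
apply: (mulfI two_neq0); rewrite big_distrr /=.
under eq_bigr => a _ do rewrite mul_sin_sin -mulrBr -mulrDr.
rewrite sumrB sum_cos_angle_diff sum_cos_angle_sum /snorm.
by case: (i == j); case: (i.+1 == n) => /=; field.
Qed.

(** A right inverse of a square matrix is also a left inverse. *)
Lemma smx_col_orthogonal n (a b : 'I_n) :
  \sum_i (snorm i)^-1 * (smx i a * smx i b) = (a == b)%:R.
Proof.
pose A : 'M[R]_n := \matrix_(i, c) smx i c.
pose B : 'M[R]_n := \matrix_(c, i) ((snorm i)^-1 * smx i c).
have AB1 : A *m B = 1%:M.
  apply/matrixP => i j; rewrite !mxE.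
  under eq_bigr => c _ do rewrite !mxE mulrCA.
  rewrite -big_distrr smx_row_orthogonal /=.
  have [->|_] := eqVneq; last by rewrite mul0r mulr0.
  by rewrite mul1r mulVf ?snorm_neq0.
have /matrixP/(_ a b) := mulmx1C AB1; rewrite !mxE => <-.
by apply: eq_bigr => i _; rewrite !mxE mulrA.
Qed.

Lemma dagC1_interval n (a b c : nat) : (a < n)%N -> (b < n)%N ->
  `[< dagC1 n.*2 (c, a, b) >] =
  (maxn a b - minn a b <= c < (minn (a + b) (n.*2 - 2 - a - b)).+1)%N.
Proof. by move=> an bn; apply/asboolP/idP; rewrite /dagC1 /=; lia. Qed.

(** For fixed a and b the admissible c form an interval, over which the sum
telescopes. If the upper end is a + b, the result is the product formula for
sines. If it is P - 2 - a - b, the cosine at that end is the same because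
2 P (pi (i+1) / P) is a multiple of 2 pi. *)
Lemma smx_clebsch_gordan n (i a b : 'I_n) :
  smx i a * smx i b =
  sin (angle n i.+1) *
    \sum_(c < n) `[< dagC1 n.*2 (val c, val a, val b) >]%:R * smx i c.
Proof.
have [an bn] := (ltn_ord a, ltn_ord b).
have two_neq0 : 2 != 0 :> R by rewrite pnatr_eq0.
set lo := (maxn a b - minn a b)%N.
set hi := (minn (a + b) (n.*2 - 2 - a - b)).+1.
have lohi : (lo <= hi)%N by lia.
have hin : (hi <= n)%N by lia.
under eq_bigr => c _ do rewrite dagC1_interval //.
set x := angle n i.+1.
have -> : \sum_(c < n) (lo <= c < hi)%:R * smx i c =
          \sum_(lo <= c < hi) sin (c.*2.+1%:R * x).
  rewrite (big_nat_widen _ _ n) // (big_nat_widenl _ 0%N) // big_mkord.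
  rewrite [RHS]big_mkcond; apply: eq_bigr => c _.
  by rewrite andTb andbC; case: ifP => _; rewrite ?mul1r ?mul0r.
apply: (mulfI two_neq0); rewrite mul_sin_sin.
rewrite [2 * (_ * _)]mulrA sum_sin_odd // -/x.
congr (_ - _).
  rewrite -mulrBl /lo /maxn /minn; case: ltnP => ab.
    rewrite -cosN doubleB natrB ?leq_double 1?ltnW // -mulNr -!natr1.
    by congr cos; ring.
  by rewrite doubleB natrB ?leq_double // -!natr1; congr cos; ring.
rewrite -mulrDl /hi /minn; case: ltnP => ab.
  by congr cos; rewrite doubleS doubleD -!natr1 natrD; ring.
(* The truncated case: reflect the upper end by periodicity of cos. *)
have -> : (n.*2 - 2 - a - b).+1.*2 = (n.*2.*2 - (a.*2.+1 + b.*2.+1))%N by lia.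
rewrite natrB; last by lia.
rewrite mulrBl natrD cosB.
have -> : n.*2.*2%:R * x = pi *+ i.+1 *+ 2.
  by rewrite -[n.*2.*2]muln2 natrM mulrAC angle_mul ?mulr_natr //; lia.
rewrite sin_mulr2n sin_pi_mulrn mulr0 mul0rn mul0r addr0.
by rewrite cos_mulr2n cos2sin2 sin_pi_mulrn expr0n subr0 mulr2n addrK mul1r.
Qed.

Definition fusion_weight n (i : 'I_n) : R := (snorm i * sin (angle n i.+1))^-1.

(** The Verlinde formula: expand s_i(a) s_i(b) by [smx_clebsch_gordan] and read
off the coefficient of s_i(c) by orthogonality of the columns. *)
Lemma fusion_rule n (a b c : 'I_n) :
  \sum_i fusion_weight i * (smx i a * smx i b * smx i c) =
  `[< dagC1 n.*2 (val c, val a, val b) >]%:R.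
Proof.
under eq_bigr => i _.
  have -> : fusion_weight i * (smx i a * smx i b * smx i c) =
     \sum_e `[< dagC1 n.*2 (val e, val a, val b) >]%:R *
       ((snorm i)^-1 * (smx i e * smx i c)).
    have xi : sin (angle n i.+1) != 0.
      by rewrite gt_eqF // sin_angle_gt0 //; have := ltn_ord i; lia.
    rewrite smx_clebsch_gordan /fusion_weight invfM.
    rewrite -!mulrA mulKf // big_distrl big_distrr.
    by apply: eq_bigr => e _ /=; ring.
  over.
rewrite exchange_big /=.
under eq_bigr => e _ do rewrite -big_distrr smx_col_orthogonal.
rewrite (bigD1 c) //= eqxx mulr1 big1 ?addr0 // => e /negPf ->.
by rewrite mulr0.
Qed.

End Trigonometry.

(** * Admissible labellings *)

Section Counting.
Variables (R : realType) (n : nat) (G : graph).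

Definition forget_bound (l : {ffun edge G -> 'I_n}) : {ffun edge G -> nat} :=
  [ffun e => val (l e)].

(** Admissible labels are smaller than n = P / 2, so the labellings can be
counted inside a finite type. *)
Definition bounded_Ed : {set {ffun edge G -> 'I_n}} :=
  [set l : {ffun edge G -> 'I_n} | `[< Ed n.*2 G (forget_bound l) >]]%SET.

Lemma forget_bound_inj : injective forget_bound.
Proof.
move=> l l' /ffunP eq_ll'; apply/ffunP => e.
by apply: val_inj; have := eq_ll' e; rewrite !ffunE.
Qed.

Hypothesis tri : trivalent G.

Lemma trivalent_branches (v : vertex G) : exists h1 h2 h3 : half_edge G,
  [/\ h1 != h2, h1 != h3, h2 != h3 & branches v = [set h1; h2; h3]%SET].
Proof.
have /card_gt2P[h1 [h2 [h3 [[i1 i2 i3] [n12 n23 n31]]]]] : (2 < #|branches v|)%N.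
  by rewrite tri.
have n13 : h1 != h3 by rewrite eq_sym.
exists h1, h2, h3; split=> //; apply/esym/eqP.
rewrite eqEcard tri -finset.setUA cardsU1 cards2 !inE negb_or n12 n13 n23 finset.setUA.
apply/andP; split=> //; rewrite !inE in i1 i2 i3.
by apply/fintype.subsetP => k; rewrite !inE => /orP[/orP[]|]/eqP->.
Qed.

(** A description of admissibility at v that is visibly independent of the order
of the branches, so that admissibility can be tested on a single ordering. *)
Lemma dagC1_branches (P : nat) (l : edge G -> nat) (v : vertex G)
    (h1 h2 h3 : half_edge G) :
  branches v = [set h1; h2; h3]%SET ->
  let S := (\sum_(h in branches v) l (eps h))%N in
  dagC1 P (l (eps h1), l (eps h2), l (eps h3)) <->
  (S <= P - 2)%N /\ {in branches v, forall h, (2 * l (eps h) <= S)%N}.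
Proof.
move=> vE S; have uh : uniq [:: h1; h2; h3].
  apply/card_uniqP; rewrite -[RHS](tri v) vE; apply: eq_card => k.
  by rewrite !inE orbA.
have SE : S = (l (eps h1) + l (eps h2) + l (eps h3))%N.
  move: uh; rewrite /S vE -finset.setUA /= !inE andbT => /andP[n1 n23].
  by rewrite !big_setU1 ?inE //= big_set1 addnA.
rewrite /dagC1 /= vE SE; split=> [dag|[lS dag]].
  split=> [|h]; first by lia.
  by rewrite !inE => /orP[/orP[]|]/eqP->; lia.
have := (dag h1, dag h2, dag h3); rewrite !inE !eqxx !orbT.
by move=> [[/(_ isT) ? /(_ isT) ?] /(_ isT) ?]; lia.
Qed.

Lemma Ed_bounded :
  (0 < n)%N -> Ed n.*2 G = (forget_bound @` [set` bounded_Ed])%classic.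
Proof.
move=> n_gt0; apply/seteqP; split=> [l lEd|_ [l + <-]]; last first.
  by rewrite /= inE => /asboolP.
have ltn e : (l e < n)%N.
  have [h [_ [_ <- _]]] := edge_halves e.
  have [h1 [h2 [h3 [_ _ _ vE]]]] := trivalent_branches (nu h).
  have := lEd _ _ _ _ vE; rewrite /dagC1 /=.
  have : h \in branches (nu h) by rewrite inE.
  by rewrite vE !inE => /orP[/orP[]|]/eqP->; lia.
have lE : forget_bound [ffun e => Ordinal (ltn e)] = l.
  by apply/ffunP => e; rewrite !ffunE.
by exists [ffun e => Ordinal (ltn e)] => //; rewrite /= inE lE; apply/asboolP.
Qed.

Lemma card_Ed : (0 < n)%N ->
  finite_set (Ed n.*2 G) /\ #|` fset_set (Ed n.*2 G)| = #|bounded_Ed|.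
Proof.
move=> n_gt0; rewrite Ed_bounded //; split; first exact/finite_image/finite_finset.
rewrite fset_set_image ?finite_finset //.
rewrite card_imfset /=; last exact: forget_bound_inj.
rewrite cardE; apply/perm_size/uniq_perm; rewrite ?fset_uniq ?enum_uniq // => l.
by rewrite mem_enum in_fset_set ?finite_finset // mem_setE.
Qed.

(** The fusion rule at a vertex, in the form needed by [state_sum]. *)
Lemma vertex_weight (l : {ffun edge G -> 'I_n}) (v : vertex G) :
  \sum_i fusion_weight R i * \prod_(h in branches v) smx R i (l (eps h)) =
  `[< forall h1 h2 h3, branches v = [set h1; h2; h3]%SET ->
       dagC1 n.*2 (val (l (eps h1)), val (l (eps h2)), val (l (eps h3))) >]%:R.
Proof.
have [h1 [h2 [h3 [n12 n13 n23 vE]]]] := trivalent_branches v.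
transitivity (`[< dagC1 n.*2
  (val (l (eps h3)), val (l (eps h1)), val (l (eps h2))) >]%:R : R).
  rewrite -fusion_rule; apply: eq_bigr => i _; congr (_ * _); rewrite vE.
  rewrite -finset.setUA !big_setU1 ?inE ?negb_or ?n12 ?n13 //= big_set1.
  by rewrite mulrA.
congr (nat_of_bool _)%:R; apply: asbool_equiv_eq.
have vE' : branches v = [set h3; h1; h2]%SET.
  by rewrite vE finset.setUC finset.setUA.
pose lv e := val (l e).
split=> [/(dagC1_branches _ lv vE') dag k1 k2 k3 kE|dag].
  exact/(dagC1_branches _ lv kE).
exact: dag vE'.
Qed.

End Counting.

(** * The count *)

Lemma card_bounded_Ed (R : realType) (n : nat) (G : graph) :
    trivalent G -> connected_graph G ->
  #|bounded_Ed n G|%:R =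
  \sum_(i < n) fusion_weight R i ^+ #|vertex G| * snorm R i ^+ #|edge G| :> R.
Proof.
move=> tri conn; rewrite -(state_sum _ conn (@smx_row_orthogonal R n)).
rewrite -sum1_card natr_sum big_mkcond; apply: eq_bigr => l _.
under [RHS]eq_bigr => v _ do rewrite vertex_weight //.
rewrite inE; case: asboolP => [lEd|lNEd].
  rewrite big1 // => v _; case: asboolP => // -[] h1 h2 h3 vE.
  by have := lEd _ _ _ _ vE; rewrite !ffunE.
apply/esym/eqP/prodf_eq0; apply: contrapT => noV.
apply: lNEd => v h1 h2 h3 vE; rewrite !ffunE; apply: contrapT => ndag.
apply: noV; exists v => //; rewrite pnatr_eq0 eqb0.
by apply/asboolPn => /(_ h1 h2 h3 vE).
Qed.

Lemma trivalent_genus (G : graph) (g : nat) :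
    trivalent G -> genus G = g%:Z -> (2 <= g)%N ->
  #|vertex G| = (2 * (g - 1))%N /\ #|edge G| = (3 * (g - 1))%N.
Proof. by move=> /handshake; rewrite /genus; lia. Qed.

Lemma fusion_weight_power (R : realType) n (i : 'I_n) k :
  fusion_weight R i ^+ (2 * k) * snorm R i ^+ (3 * k) =
  snorm R i ^+ k * csc (angle R n i.+1) ^+ (2 * k).
Proof.
rewrite /fusion_weight /csc invfM exprMn mulrAC; congr (_ * _).
have -> : (3 * k = k + 2 * k)%N by lia.
by rewrite exprVn mulrC exprD mulfK // expf_neq0 // snorm_neq0.
Qed.

Theorem mainTheorem3 (R : realType) (P : nat) (hP : (2 <= P)%N)
    (hPeven : ~~ odd P) (G : graph) (hconn : connected_graph G)
    (htri : trivalent G) (g : nat) (hg : genus G = g%:Z) (hg2 : (2 <= g)%N) :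
  finite_set (Ed P G) /\
  #|` fset_set (Ed P G)|%:R =
    (P%:R / 2) ^+ (g - 1) +
    (P%:R / 4) ^+ (g - 1) *
      \sum_(1 <= theta < P./2)
        csc (pi * theta%:R / P%:R) ^+ (2 * g - 2) :> R.
Proof.
have [m Pm] : exists m, P = m.+1.*2 by exists P./2.-1; lia.
rewrite {}Pm {P hP hPeven} doubleK.
have [finEd ->] := card_Ed htri (ltn0Sn m).
split=> //; have [vE eE] := trivalent_genus htri hg hg2.
rewrite card_bounded_Ed // vE eE.
under eq_bigr => i _ do rewrite fusion_weight_power.
rewrite big_ord_recr [RHS]addrC /=; congr (_ + _); last first.
  (* The last row, where the sine is sin (pi / 2). *)
  rewrite /snorm eqxx /csc /angle -muln2 natrM mulfK ?pnatr_eq0 //.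
  have -> : pi *+ m.+1 / (m.+1%:R * 2) = pi / 2 :> R.
    by rewrite -[pi *+ _]mulr_natr; field; rewrite nat1r pnatr_eq0.
  by rewrite sin_pihalf invr1 expr1n mulr1.
rewrite big_add1 big_mkord big_distrr; apply: eq_bigr => i _ /=.
rewrite mulnBr muln1 /snorm /= eqSS (ltn_eqF (ltn_ord i)).
rewrite /angle -[pi *+ _]mulr_natr.
by congr (_ ^+ _ * _); rewrite -muln2 natrM; field.
Qed.
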